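(* Let $\beta\in\mathbb{D}$ be fixed and let $T$ be the weighted shift operator on the Bergman space $A^2(\mathbb{D})$ defined by $T\left(\sum_{n\ge0}a_n\sqrt{n+1}\,z^n\right)=\sum_{n\ge0}a_n\beta_{n+1}z^{n+1}$, with weights $\beta_n=\beta^{n-1}$ (so $\beta_{n+1}=\beta^{n}$ for $n\ge0$, with $\beta^0=1$). Then the Berezin range $\mathrm{Ber}(T)$ is a disc centred at the origin, and is therefore convex.
   Context: $\mathbb{D}$ is the open unit disc in $\mathbb{C}$. $A^2(\mathbb{D})$ is the Bergman space of holomorphic functions on $\mathbb{D}$ that are square-integrable with respect to normalized area measure. For $f(z)=\sum_{n\ge 0} a_nz^n$ and $g(z)=\sum_{n\ge 0} b_nz^n$ in $A^2(\mathbb{D})$, $\langle f,g\rangle=\sum_{n\ge0}\frac{1}{n+1}a_n\overline{b_n}$. Its reproducing kernel is $k_\lambda(z)=\frac1{(1-\bar\lambda z)^2}=\sum_{n\ge0}(n+1)\bar\lambda^nz^n$, and the normalized kernel is $\hat k_\lambda=k_\lambda/\|k_\lambda\|$. For a bounded operator $T$ on $A^2(\mathbb{D})$, the Berezin range is $\mathrm{Ber}(T)=\{\langle T\hat k_\lambda,\hat k_\lambda\rangle:\lambda\in\mathbb{D}\}$. The disc may be open or closed. *)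

(* Defs.v *)
From HB Require Import structures.
From mathcomp Require Import all_boot all_order all_algebra.
From mathcomp Require Import complex.
From mathcomp Require Import all_classical all_reals all_analysis.

Set Implicit Arguments.
Unset Strict Implicit.
Unset Printing Implicit Defensive.

Import Order.TTheory GRing.Theory Num.Theory.
Import numFieldNormedType.Exports.

Local Open Scope classical_set_scope.
Local Open Scope ring_scope.
Local Open Scope complex_scope.

(* R[i] as a normed space over itself, so that derivability over R[i] is
   complex differentiability. *)
HB.instance Definition _ (R : realType) := NormedModule.copy R[i] R[i]^o.

Definition unit_disc (R : realType) : set R[i] := [set z | `|z| < 1].

Definition holomorphic_on_disc (R : realType) (f : R[i] -> R[i]) :=
  forall z, unit_disc z -> derivable f z 1.

Lemma invr_pi_ge0 (R : realType) : 0 <= (pi : R)^-1.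
Proof. by rewrite invr_ge0 pi_ge0. Qed.

Definition normalized_area (R : realType) :=
  mscale (NngNum (invr_pi_ge0 R)) (@lebesgue_measure R \x @lebesgue_measure R)%E.

(* An element of A^2(D) is represented by a total function, whose values
   outside the disc are irrelevant. *)
Definition bergman (R : realType) : set (R[i] -> R[i]) :=
  [set f | holomorphic_on_disc f /\
    (\int[@normalized_area R]_(p in [set p : R * R | unit_disc (p.1 +i* p.2)])
        (ComplexField.Normc.normc (f (p.1 +i* p.2)) ^+ 2)%:E < +oo)%E].

Definition expansion (R : realType) (f : R[i] -> R[i]) (a : nat -> R[i]) :=
  forall z, unit_disc z -> series (fun n => a n * z ^+ n) @ \oo --> f z.

Definition coef (R : realType) (f : R[i] -> R[i]) : nat -> R[i] :=
  get [set a | expansion f a].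

Definition inner (R : realType) (f g : R[i] -> R[i]) : R[i] :=
  limn (series (fun n => n.+1%:R^-1 * coef f n * (coef g n)^*)).

Definition bergman_norm (R : realType) (f : R[i] -> R[i]) : R[i] :=
  sqrtC (inner f f).

Definition bergman_kernel (R : realType) (lambda : R[i]) : R[i] -> R[i] :=
  fun z => ((1 - lambda^* * z) ^+ 2)^-1.

Definition normalized_kernel (R : realType) (lambda : R[i]) : R[i] -> R[i] :=
  fun z => bergman_kernel lambda z / bergman_norm (bergman_kernel lambda).

Definition Ber (R : realType) (T : (R[i] -> R[i]) -> (R[i] -> R[i])) : set R[i] :=
  [set inner (T (normalized_kernel lambda)) (normalized_kernel lambda)
     | lambda in @unit_disc R].

(* T maps A^2(D) to itself, sending
   sum_n a_n sqrt(n+1) z^n to sum_n a_n w_(n+1) z^(n+1).  Such a T is unique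
   up to values outside the disc; the weight w 0 plays no role. *)
Definition weighted_shift (R : realType) (w : nat -> R[i])
    (T : (R[i] -> R[i]) -> (R[i] -> R[i])) :=
  forall (f : R[i] -> R[i]) (a : nat -> R[i]), bergman f ->
    expansion f (fun n => a n * (Num.sqrt n.+1%:R)%:C) ->
    bergman (T f) /\
    forall z, unit_disc z ->
      series (fun n => a n * w n.+1 * z ^+ n.+1) @ \oo --> T f z.

(* Open or closed, of positive radius. *)
Definition centred_disc (R : realType) (A : set R[i]) :=
  exists2 r : R, 0 < r &
    A = [set z | `|z| < r%:C] \/ A = [set z | `|z| <= r%:C].

(* Main.v *)
Require Import Defs.
From mathcomp Require Import all_boot all_order all_algebra.
From mathcomp Require Import complex ring lra.
From mathcomp Require Import all_classical all_reals all_analysis.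

(* With r = |lambda|, comparing coefficients gives
   <T k^_lambda, k^_lambda> = lambda (1 - r^2)^2 G(r^2), where
   G(t) = sum_n sqrt(n+1) (t beta)^n is [shift_symbol beta t].  Hence the
   Berezin range is invariant under rotations and the moduli of its points are
   the values on [0, 1[ of phi(r) = r (1 - r^2)^2 |G(r^2)|, which is
   [berezin_radius beta r].  Since |beta| < 1, G is Lipschitz on [0, 1], so phi
   is continuous there; it vanishes at 0 and 1 and is positive somewhere because
   G(0) = 1.  Its maximum is therefore attained at some c < 1, and by the
   intermediate value theorem the range is the closed disc of radius phi(c). *)

Set Implicit Arguments.
Unset Strict Implicit.
Unset Printing Implicit Defensive.

Import Order.TTheory GRing.Theory Num.Theory.
Import numFieldNormedType.Exports.
Import ComplexField.Normc.
Local Open Scope classical_set_scope.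
Local Open Scope ring_scope.
Local Open Scope complex_scope.

Section ComplexSequences.
Variable R : realType.
Implicit Types (u : R[i]^nat) (x z l : R[i]).

Lemma normr_normc z : `|z| = (normc z)%:C. Proof. by case: z. Qed.

Lemma normc_ge0 z : 0 <= normc z.
Proof. by case: z => a b; rewrite sqrtr_ge0. Qed.

Lemma normc_eq0 z : (normc z == 0) = (z == 0).
Proof. by rewrite -(inj_eq (@complexI R)) -normr_normc normr_eq0. Qed.

Lemma normc_real (r : R) : normc r%:C = `|r|.
Proof. by rewrite /= expr0n /= addr0 sqrtr_sqr. Qed.

Lemma normcX x n : normc (x ^+ n) = normc x ^+ n.
Proof. by apply: (@complexI R); rewrite rmorphXn -!normr_normc normrX. Qed.

Lemma ler_normc_sum n (F : nat -> R[i]) :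
  normc (\sum_(0 <= k < n) F k) <= \sum_(0 <= k < n) normc (F k).
Proof.
by rewrite -(@lecR R) rmorph_sum -normr_normc (le_trans (ler_norm_sum _ _ _)).
Qed.

Lemma ler_dist_normc x z : `|normc x - normc z| <= normc (x - z).
Proof.
by have := ler_dist_dist x z; rewrite !normr_normc -rmorphB normc_real lecR.
Qed.

(* Inside products Defs.v's [^*] parses as [Num.conj], elsewhere as [conjc];
   [^*%R] always selects the former. *)
Lemma normc_conj z : normc z^*%R = normc z.
Proof. by apply: (@complexI R); rewrite -!normr_normc norm_conjC. Qed.

Lemma unit_discE z : unit_disc z = (normc z < 1).
Proof. by rewrite /unit_disc /mkset normr_normc -(ltcR (normc z)). Qed.

Lemma cvg_normcP u l : u @ \oo --> l <-> normc (u n - l) @[n --> \oo] --> (0 : R).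
Proof.
split=> [/cvgrPdist_lt ul|/cvgrPdist_lt ul]; apply/cvgrPdist_lt => e e0.
  near=> n; rewrite sub0r normrN ger0_norm ?normc_ge0//.
  rewrite -(ltcR _ e) -normr_normc distrC; near: n; apply: ul.
  by rewrite ltcR.
have eE : e = (complex.Re e)%:C by rewrite RRe_real// gtr0_real.
rewrite eE; near=> n; rewrite distrC normr_normc ltcR.
rewrite -[ltLHS]ger0_norm ?normc_ge0// -normrN -sub0r.
by near: n; apply: ul; rewrite -ltcR -eE.
Unshelve. all: by end_near. Qed.

Lemma cvg_complex u l : (@complex.Re R \o u) @ \oo --> complex.Re l ->
  (@complex.Im R \o u) @ \oo --> complex.Im l -> u @ \oo --> l.
Proof.
move=> ure uim; apply/cvg_normcP.
apply: (@squeeze_cvgr _ _ _ _ (cst 0)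
  (fun n => `|complex.Re (u n) - complex.Re l| + `|complex.Im (u n) - complex.Im l|)).
- near=> n; rewrite normc_ge0/=.
  case: (u n) => a b; case: l {ure uim} => c d /=.
  rewrite -[leRHS]ger0_norm ?addr_ge0// -sqrtr_sqr ler_wsqrtr//.
  rewrite -(real_normK (num_real (a-c))) -(real_normK (num_real (b-d))).
  by rewrite sqrrD addrAC lerDl mulrn_wge0// mulr_ge0.
- exact: cvg_cst.
- rewrite -[X in _ --> X](addr0 (0 : R)); apply: cvgD; apply/norm_cvg0P;
    exact/subr_cvg0.
Unshelve. all: by end_near. Qed.

Lemma normc_cvg_series u : cvgn (series (fun n => normc (u n))) -> cvgn (series u).
Proof.
move=> cu.
have H (p : {additive R[i] -> R}) : (forall z, `|p z| <= normc z) ->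
    p \o series u @ \oo --> limn (series (p \o u)).
  move=> hp.
  have -> : p \o series u = series (p \o u).
    by apply/funext => n; rewrite /series/= raddf_sum.
  apply: (@normed_cvg R R^o).
  by apply: series_le_cvg cu => n //=; rewrite ?normc_ge0 ?hp.
apply/cvg_ex; exists (limn (series (@complex.Re R \o u)) +i* limn (series (@complex.Im R \o u))).
apply: cvg_complex.
- apply: H => z; rewrite -lecR -normr_normc; exact: normc_ge_Re.
- apply: H => -[a b] /=; rewrite -sqrtr_sqr ler_wsqrtr// lerDr.
  exact: sqr_ge0.
Qed.

Lemma cvg_normc u l : u @ \oo --> l -> normc (u n) @[n --> \oo] --> normc l.
Proof.
move=> /cvg_normcP /cvgrPdist_lt ul; apply/cvgrPdist_lt => e e0.
near=> n.
have : normc (u n - l) < e.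
  rewrite -[ltLHS]ger0_norm ?normc_ge0// -normrN -sub0r; near: n; exact: ul.
apply: le_lt_trans.
by rewrite distrC ler_dist_normc.
Unshelve. all: by end_near. Qed.

Lemma normc_lim_series_le u (v : R^nat) l V : (forall n, normc (u n) <= v n) ->
  series u @ \oo --> l -> series v @ \oo --> V -> normc l <= V.
Proof.
move=> uv ul vV; apply: (ler_cvg_to (cvg_normc ul) vV); apply: nearW => n.
by apply: (le_trans (ler_normc_sum _ _)); apply: ler_sum => k _.
Qed.
End ComplexSequences.

Section Series.
Variable R : realType.
Implicit Types (c u : R[i]^nat) (t : R) (x z l : R[i]).

Lemma cvg_seriesZ (K : numFieldType) (u : K^nat) (k l : K) :
  series u @ \oo --> l -> series (fun n => k * u n) @ \oo --> k * l.
Proof.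
have -> : series (fun n => k * u n) = (fun n => k * series u n).
  by apply/funext => n; rewrite /series/= mulr_sumr.
by move=> ul; apply: cvgM ul; exact: cvg_cst.
Qed.

Lemma cvg_seriesB (K : numFieldType) (u v : K^nat) (a b : K) :
  series u @ \oo --> a -> series v @ \oo --> b ->
  series (fun n => u n - v n) @ \oo --> a - b.
Proof.
have -> : series (fun n => u n - v n) = (fun n => series u n - series v n).
  by apply/funext => n; rewrite /series/= sumrB.
exact: cvgB.
Qed.

Lemma cvg_scale1BD (K : numFieldType) (u v : K^nat) (k : K) :
  u @ \oo --> 0 -> v @ \oo --> 0 -> (fun n => k * (1 - u n + v n)) @ \oo --> k.
Proof.
move=> u0 v0; rewrite -[X in _ --> X]mulr1 -[in X in _ --> X](subr0 1).
rewrite -[in X in _ --> X](addr0 (1 - 0)).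
apply: cvgM; first exact: cvg_cst.
by apply: cvgD v0; apply: cvgB u0; exact: cvg_cst.
Qed.

Lemma sum_succ_expr (A : comNzRingType) (x : A) n :
  (1 - x) ^+ 2 * \sum_(0 <= k < n) k.+1%:R * x ^+ k =
  1 - n.+1%:R * x ^+ n + n%:R * x ^+ n.+1.
Proof.
elim: n => [|n IH]; first by rewrite big_geq//; ring.
by rewrite big_nat_recr//= mulrDr IH !exprS -!(natr1 n) -(natr1 n.+1) -(natr1 n); ring.
Qed.

Lemma is_cvg_series_succ_expr t : 0 <= t < 1 ->
  cvgn (series (fun n => n.+1%:R * t ^+ n)).
Proof.
move=> /andP[t0 t1]; apply: nondecreasing_is_cvgn.
  by apply: nondecreasing_series => n _ _; rewrite mulr_ge0// exprn_ge0.
exists ((1 - t) ^+ 2)^-1 => _ [n _ <-].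
have d0 : 0 < (1 - t) ^+ 2 by rewrite exprn_gt0// subr_gt0.
rewrite -[leRHS]mulr1 ler_pdivlMl// sum_succ_expr.
rewrite exprS mulrA -addrA gerDl addrC subr_le0 ler_wpM2r ?exprn_ge0//.
by rewrite (le_trans (ler_piMr _ (ltW t1)))// ler_nat.
Qed.

Lemma is_cvg_series_succ_sqr_expr t : 0 <= t < 1 ->
  cvgn (series (fun n => n.+1%:R ^+ 2 * t ^+ n)).
Proof.
move=> /andP[t0 t1]; set s := Num.sqrt t.
(* Since [(n+1) s^n] is bounded, [(n+1)^2 t^n] is at most a multiple of it. *)
have s01 : 0 <= s < 1 by rewrite sqrtr_ge0 -[ltRHS]sqrtr1 ltr_sqrt.
have cs := is_cvg_series_succ_expr s01.
have [M [_ Mb]] := cvg_series_bounded cs.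
have {}Mb n : n.+1%:R * s ^+ n <= `|M| + 1.
  by apply: le_trans (ler_norm _) (Mb (`|M| + 1) _ n I); rewrite ltr_pwDr// ler_norm.
apply: (@series_le_cvg _ _ (fun n => (`|M| + 1) * (n.+1%:R * s ^+ n))).
- by move=> n; rewrite mulr_ge0// ?exprn_ge0.
- by move=> n; rewrite !mulr_ge0// ?addr_ge0// exprn_ge0// sqrtr_ge0.
- move=> n; rewrite -[t]sqr_sqrtr// -/s -exprM mulnC exprM -exprMn expr2.
  by rewrite ler_wpM2r// mulr_ge0// exprn_ge0// sqrtr_ge0.
- by apply/cvg_ex; eexists; apply: cvg_seriesZ cs.
Qed.

Lemma cvg_series_succ_expr x : normc x < 1 ->
  series (fun n => n.+1%:R * x ^+ n) @ \oo --> ((1 - x) ^+ 2)^-1.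
Proof.
move=> x1.
have t01 : 0 <= normc x < 1 by rewrite normc_ge0.
have /cvg_series_cvg_0 h := is_cvg_series_succ_expr t01.
have normc_nat n : normc (n%:R : R[i]) = n%:R.
  by rewrite -(rmorph_nat (real_complex R)) normc_real ger0_norm.
have h1 : (fun n => n.+1%:R * x ^+ n) @ \oo --> (0 : R[i]).
  by apply/cvg_normcP; under eq_fun do rewrite subr0 normcM normcX normc_nat.
have h2 : (fun n => n%:R * x ^+ n.+1) @ \oo --> (0 : R[i]).
  apply/cvg_normcP; apply: squeeze_cvgr (cvg_cst 0) h; apply: nearW => n.
  rewrite subr0 normc_ge0/= normcM normcX normc_nat.
  rewrite ler_pM ?exprn_ge0 ?normc_ge0// ?ler_nat// exprS.
  by rewrite ler_piMl ?exprn_ge0 ?normc_ge0// ltW.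
have nx0 : (1 - x) ^+ 2 != 0.
  by rewrite expf_eq0/= subr_eq0; apply: contraTneq x1 => <-; rewrite normc1 ltxx.
have -> : series (fun n => n.+1%:R * x ^+ n) =
    (fun n => ((1 - x) ^+ 2)^-1 * (1 - n.+1%:R * x ^+ n + n%:R * x ^+ n.+1)).
  by apply/funext => n; rewrite /series/= -sum_succ_expr mulKf.
exact: cvg_scale1BD.
Qed.

Lemma cvg_series_delta (K : numFieldType) (a : K) n :
  series (fun k => if k == n then a else 0) @ \oo --> a.
Proof.
apply: cvg_near_cst; near=> N; rewrite /series/= -big_mkcond big_nat1_eq/=.
by case: ifPn => // /negP[]; near: N; exists n.+1.
Unshelve. all: by end_near. Qed.

Lemma power_series_eq0 c :
  (forall z, normc z < 1 -> series (fun n => c n * z ^+ n) @ \oo --> 0) ->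
  forall n, c n = 0.
Proof.
move=> c0; elim/ltn_ind => n IH.
have [M [_ Mb]] : bounded_fun (fun k => normc (c k * 2^-1 ^+ k)).
  apply: cvg_seq_bounded; apply/cvg_ex; exists (normc 0); apply: cvg_normc.
  apply: cvg_series_cvg_0; apply/cvg_ex; exists 0; apply: c0.
  have -> : 2^-1 = (2^-1)%:C :> R[i] by rewrite -(rmorph_nat (real_complex R)) fmorphV.
  by rewrite normc_real; rewrite ger0_norm; lra.
have {}Mb k : normc (c k) <= (`|M| + 1) * 2 ^+ k.
  have : normc (c k * 2^-1 ^+ k) <= `|M| + 1.
    apply: le_trans (ler_norm _) (Mb (`|M| + 1) _ k I).
    by rewrite ltr_pwDr// ler_norm.
  have e2 : normc (2 : R[i]) = 2.
    by rewrite -(rmorph_nat (real_complex R)) normc_real ger0_norm.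
  by rewrite normcM normcX normcV e2 exprVn ler_pdivrMr// exprn_gt0.
set A := `|M| + 1 in Mb.
have A0 : 0 < A by rewrite /A ltr_wpDl.
have bd d : 0 < d <= 4^-1 -> normc (c n) <= A * 4 ^+ n.+1 * 2 * d.
  move=> /andP[d0 d4].
  have dC : normc d%:C = d by rewrite normc_real gtr0_norm.
  pose v : R^nat := geometric (A * (4 * d) ^+ n.+1) 2^-1.
  pose u k := c k * d%:C ^+ k - (if k == n then c n * d%:C ^+ n else 0).
  have uv k : normc (u k) <= v k.
    have v0 : 0 <= v k.
      by rewrite /v/= !mulr_ge0 ?exprn_ge0 ?mulr_ge0 ?(ltW A0) ?(ltW d0).
    (* [(2 d)^k <= (4 d)^(n+1) 2^-k] for [k > n], as [4 d <= 1]. *)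
    rewrite /u; case: ltngtP => [kn|nk|kn].
    - by rewrite IH// mul0r subr0 normc0.
    - rewrite subr0 normcM normcX dC /v/=.
      apply: (@le_trans _ _ (A * (2 * d) ^+ k)).
        by rewrite exprMn mulrA ler_wpM2r// exprn_ge0// ltW.
      rewrite -mulrA ler_pM2l//.
      have -> : 2 * d = (4 * d) * 2^-1 by lra.
      rewrite exprMn ler_wpM2r ?exprn_ge0//.
      apply: ler_wiXn2l => //; lra.
    - by rewrite -kn subrr normc0.
  have su : series u @ \oo --> - (c n * d%:C ^+ n).
    have d1 : normc d%:C < 1 by rewrite dC; lra.
    by rewrite -sub0r; have := cvg_seriesB (c0 _ d1) (@cvg_series_delta _ (c n * d%:C ^+ n) n).
  have h : `|2^-1 : R| < 1 by rewrite ger0_norm; lra.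
  have := normc_lim_series_le uv su (cvg_geometric_series h).
  rewrite normcN normcM normcX dC => le1.
  have dn : 0 < d ^+ n by rewrite exprn_gt0.
  rewrite -(ler_pM2r dn) (le_trans le1)//.
  have -> : (1 - 2^-1)^-1 = 2 :> R.
    have -> : 1 - 2^-1 = 2^-1 :> R by lra.
    exact: invrK.
  by rewrite exprMn (exprS d) le_eqVlt; apply/orP; left; apply/eqP; ring.
apply/eqP; rewrite -normc_eq0 eq_le normc_ge0 andbT.
apply/ler_addgt0Pl => e e0; rewrite addr0.
set K := A * 4 ^+ n.+1 * 2 in bd.
have K0 : 0 < K by rewrite /K !mulr_gt0// exprn_gt0.
have := bd (Num.min 4^-1 (e / K)).
rewrite ge_min lexx/= lt_min divr_gt0// invr_gt0 ltr0n/= => /(_ isT).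
move=> /le_trans; apply; rewrite mulrC -ler_pdivlMr//.
by rewrite ge_min lexx orbT.
Qed.

End Series.

Section BerezinTransform.
Variable R : realType.
Implicit Types (f : R[i] -> R[i]) (a : R[i]^nat) (l z beta : R[i]).

Lemma complex_hausdorff : hausdorff_space R[i].
Proof. exact: (@norm_hausdorff R[i] R[i]^o). Qed.

Lemma cvg_lim_complex (u : R[i]^nat) l : u @ \oo --> l -> limn u = l.
Proof. exact/cvg_lim/complex_hausdorff. Qed.

Lemma cvg_series_shift (u v : R[i]^nat) l : u 0%N = 0 -> (forall n, u n.+1 = v n) ->
  series v @ \oo --> l -> series u @ \oo --> l.
Proof.
move=> u0 uv vl; rewrite -cvg_shiftS.
have -> // : (fun n => series u n.+1) = series v.
by apply/funext => n; rewrite /series/= big_nat_recl// u0 add0r; apply: eq_bigr.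
Qed.

Lemma coef_expansion f a : expansion f a -> coef f = a.
Proof.
move=> fa; have fc : expansion f (coef f) by apply: (getPex (ex_intro _ a fa)).
apply/funext => n; apply/eqP; rewrite -subr_eq0; apply/eqP.
apply: (@power_series_eq0 _ (fun n => coef f n - a n)) => z z1.
have zd : unit_disc z by rewrite unit_discE.
have := cvg_seriesB (fc z zd) (fa z zd); rewrite subrr.
by under [X in series X]eq_fun do rewrite -mulrBl.
Qed.

Lemma normc_mulJ l : l^*%R * l = (normc l ^+ 2)%:C.
Proof. by rewrite mulrC -normCK normr_normc rmorphXn. Qed.

Lemma expansion_kernel l : unit_disc l ->
  expansion (bergman_kernel l) (fun n => n.+1%:R * l^*%R ^+ n).
Proof.
rewrite unit_discE => l1 z; rewrite unit_discE => z1.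
have lz : normc (l^*%R * z) < 1.
  by rewrite normcM normc_conj mulr_ilt1 ?normc_ge0.
have := cvg_series_succ_expr lz.
by under [X in series X]eq_fun do rewrite exprMn mulrA.
Qed.

Lemma inner_kernel l : unit_disc l ->
  inner (bergman_kernel l) (bergman_kernel l) = ((1 - (normc l ^+ 2)%:C) ^+ 2)^-1.
Proof.
move=> ld; rewrite /inner (coef_expansion (expansion_kernel ld)).
have l1 := ld; rewrite unit_discE in l1.
have l2 : normc (normc l ^+ 2)%:C < 1.
  by rewrite normc_real ger0_norm ?sqr_ge0// expr_lt1 ?normc_ge0.
have := cvg_series_succ_expr l2; move=> /cvg_lim_complex <-.
congr (limn (series _)); apply/funext => n.
rewrite rmorphM rmorphXn/= conjCK rmorph_nat mulKf ?pnatr_eq0//.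
by rewrite mulrCA -exprMn normc_mulJ.
Qed.

Lemma bergman_norm_kernel l : unit_disc l ->
  bergman_norm (bergman_kernel l) = (1 - (normc l ^+ 2)%:C)^-1.
Proof.
move=> ld; rewrite /bergman_norm inner_kernel// -exprVn sqrCK// invr_ge0.
rewrite -(rmorph1 (real_complex R)) -rmorphB lecR subr_ge0.
by rewrite expr_le1 ?normc_ge0// ltW// -unit_discE.
Qed.

Lemma expansion_normalized_kernel l : unit_disc l ->
  expansion (normalized_kernel l)
    (fun n => (1 - (normc l ^+ 2)%:C) * (n.+1%:R * l^*%R ^+ n)).
Proof.
move=> ld z zd; rewrite /normalized_kernel bergman_norm_kernel// invrK mulrC.
have := cvg_seriesZ (k := 1 - (normc l ^+ 2)%:C) (expansion_kernel ld zd).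
by under [X in series X]eq_fun do rewrite mulrA.
Qed.

Definition shift_symbol beta (t : R) : R[i] :=
  limn (series (fun n => (Num.sqrt n.+1%:R)%:C * (t%:C * beta) ^+ n)).

Lemma sqrtr_succ_le n : Num.sqrt n.+1%:R <= n.+1%:R :> R.
Proof.
rewrite -[leRHS]ger0_norm// -sqrtr_sqr ler_wsqrtr//.
by rewrite -natrX ler_nat expnS leq_pmulr.
Qed.

Lemma cvg_shift_symbol beta (t : R) : normc beta < 1 -> 0 <= t <= 1 ->
  series (fun n => (Num.sqrt n.+1%:R)%:C * (t%:C * beta) ^+ n) @ \oo
    --> shift_symbol beta t.
Proof.
move=> b1 /andP[t0 t1]; apply: normc_cvg_series.
have b01 : 0 <= normc beta < 1 by rewrite normc_ge0.
apply: (series_le_cvg _ _ _ (is_cvg_series_succ_expr b01)).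
- by move=> n; rewrite normc_ge0.
- by move=> n; rewrite mulr_ge0// exprn_ge0// normc_ge0.
- move=> n; rewrite normcM normcX normcM !normc_real.
  rewrite (ger0_norm t0) ger0_norm ?sqrtr_ge0//.
  apply: ler_pM; rewrite ?sqrtr_ge0 ?exprn_ge0 ?mulr_ge0 ?normc_ge0 ?sqrtr_succ_le//.
  by rewrite lerXn2r ?nnegrE ?mulr_ge0 ?normc_ge0// ler_piMl ?normc_ge0.
Qed.

Lemma conj_kernel_coef l (r : R) m n :
  ((1 - r%:C) * (m%:R * l^*%R ^+ n))^*%R = (1 - r%:C) * (m%:R * l ^+ n).
Proof.
rewrite !rmorphM rmorphB rmorph1 rmorphXn/= conjCK rmorph_nat.
by rewrite [X in (1 - X) * _]conjc_real.
Qed.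

Lemma berezin_weighted_shift beta T l : unit_disc beta -> unit_disc l ->
  bergman (normalized_kernel l) ->
  weighted_shift (fun n => beta ^+ n.-1) T ->
  inner (T (normalized_kernel l)) (normalized_kernel l) =
    (1 - (normc l ^+ 2)%:C) ^+ 2 * l * shift_symbol beta (normc l ^+ 2).
Proof.
move=> bd ld kb; set x := normc l ^+ 2.
pose a n := (1 - x%:C) * (Num.sqrt n.+1%:R)%:C * l^*%R ^+ n.
move=> /(_ _ a kb)[|_ Tk].
  have := expansion_normalized_kernel ld; rewrite -/x; congr expansion.
  apply/funext => n; rewrite /a -(rmorph_nat (real_complex R)).
  by rewrite -{1}[n.+1%:R]sqr_sqrtr// rmorphXn; ring.
pose b n := if n is m.+1 then a m * beta ^+ m else 0.
have Tb : expansion (T (normalized_kernel l)) b.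
  by move=> z zd; apply: cvg_series_shift (Tk z zd) => [|n]; rewrite /b ?mul0r.
rewrite /inner (coef_expansion Tb) (coef_expansion (expansion_normalized_kernel ld)).
apply: cvg_lim_complex.
have b1 : normc beta < 1 by rewrite -unit_discE.
have x01 : 0 <= x <= 1.
  by rewrite sqr_ge0 expr_le1 ?normc_ge0// ltW// -unit_discE.
apply: cvg_series_shift (cvg_seriesZ (k := (1 - x%:C) ^+ 2 * l) (cvg_shift_symbol b1 x01)).
  by rewrite /b mulr0 mul0r.
move=> n; rewrite /b /a conj_kernel_coef.
have -> : x%:C = l^*%R * l by rewrite normc_mulJ.
rewrite !exprMn exprS.
have n0 : n.+2%:R != 0 :> R[i] by rewrite pnatr_eq0.
have E (K : fieldType) (m u s p q v r : K) : m != 0 ->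
    m^-1 * (u * s * p * q) * (u * (m * (v * r))) = u ^+ 2 * v * (s * (p * r * q)).
  by move=> m0; field.
exact: E.
Qed.

End BerezinTransform.

Lemma derivable_kernel (K : numFieldType) (c d z : K) : 1 - c * z != 0 ->
  derivable (fun w : K^o => ((1 - c * w) ^+ 2)^-1 / d : K^o) z 1.
Proof.
move=> cz; apply: derivableM; last exact: derivable_cst.
apply: derivableV; first by rewrite expf_eq0.
have d1 : derivable (fun w : K^o => 1 - c * w : K^o) z 1.
  apply: derivableB; first exact: derivable_cst.
  by apply: derivableM; [exact: derivable_cst|exact: derivable_id].
exact: (derivableM d1 d1).
Qed.

Lemma le_ge0_integral d (T : measurableType d) (R : realType)
    (mu : {measure set T -> \bar R}) (D E : set T) (f g : T -> \bar R) :
  (forall x, D x -> 0 <= f x)%E -> (forall x, E x -> 0 <= g x)%E ->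
  D `<=` E -> (forall x, D x -> f x <= g x)%E ->
  (\int[mu]_(x in D) f x <= \int[mu]_(x in E) g x)%E.
Proof.
move=> f0 g0 DE fg; rewrite !ge0_integralE//.
apply: ge_ereal_sup => _ [h /= hf <-]; apply: ereal_sup_ubound; exists h => //= x.
apply: (le_trans (hf x)); rewrite /patch.
case: ifPn => [/set_mem Dx|Dx].
  by rewrite mem_set ?fg//; exact: DE.
by case: ifPn => // /set_mem/g0.
Qed.

Section BergmanMembership.
Variable R : realType.
Implicit Types (l z : R[i]).

Lemma normalized_area_square_lty (r : R) :
  (@normalized_area R ([set` `[(- r)%R, r%R]] `*` [set` `[(- r)%R, r%R]]) < +oo)%E.
Proof.
rewrite /normalized_area /mscale/= product_measure1E//=.
rewrite lebesgue_measure_itv/=; case: ifPn => _; last by rewrite !mul0e mule0 ltry.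
by rewrite -EFinB -!EFinM ltry.
Qed.

Lemma bergman_bounded (f : R[i] -> R[i]) (M : R) : holomorphic_on_disc f ->
  (forall z, unit_disc z -> normc (f z) <= M) -> bergman f.
Proof.
move=> fh fM; split=> //.
pose Q : set (R * R) := [set` `[- 1, 1]] `*` [set` `[- 1, 1]].
have mQ : measurable Q by exact: measurableX.
apply: (@le_lt_trans _ _ (\int[@normalized_area R]_(p in Q) (cst (M ^+ 2)%:E) p)%E).
  apply: le_ge0_integral.
  - by move=> p _; rewrite lee_fin sqr_ge0.
  - by move=> p _; rewrite lee_fin sqr_ge0.
  - move=> [a b]; rewrite /mkset unit_discE /Q/= !in_itv/= => ab1.
    have ab2 : a ^+ 2 + b ^+ 2 <= 1.
      rewrite leNgt; apply/negP => ab; move: ab1.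
      by rewrite ltNge -[leLHS]sqrtr1 ler_wsqrtr// ltW.
    split; apply/andP; split; nra.
  - move=> p pd; rewrite lee_fin lerXn2r ?nnegrE ?fM ?normc_ge0//.
    by rewrite (le_trans (normc_ge0 _) (fM _ pd)).
rewrite integral_cst// lte_mul_pinfty ?lee_fin ?sqr_ge0//.
exact: normalized_area_square_lty.
Qed.

Lemma normc_1B_ge l z : 1 - normc l * normc z <= normc (1 - l^*%R * z).
Proof.
have := le_normcD (1 - l^*%R * z) (l^*%R * z).
by rewrite subrK normc1 normcM normc_conj lerBlDr.
Qed.

Lemma bergman_normalized_kernel l : unit_disc l -> bergman (normalized_kernel l).
Proof.
move=> ld; have l1 := ld; rewrite unit_discE in l1.
have d0 : 0 < 1 - normc l by rewrite subr_gt0.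
have nk z : unit_disc z -> 1 - normc l <= normc (1 - l^*%R * z).
  rewrite unit_discE => z1; apply: le_trans (normc_1B_ge l z).
  by rewrite lerB// ler_piMr ?normc_ge0// ltW.
apply: (@bergman_bounded _ (((1 - normc l) ^+ 2)^-1 *
    normc (bergman_norm (bergman_kernel l))^-1)).
  move=> z zd; apply: derivable_kernel.
  by rewrite -normc_eq0 gt_eqF// (lt_le_trans d0)// nk.
move=> z zd; rewrite /normalized_kernel normcM ler_wpM2r ?normc_ge0//.
rewrite normcV normcX lef_pV2 ?posrE ?exprn_gt0//; last first.
  by rewrite (lt_le_trans d0)// nk.
by rewrite lerXn2r ?nnegrE ?normc_ge0 ?nk// ltW.
Qed.
End BergmanMembership.

Lemma ler_dist_expr (A : realDomainType) (s t : A) n : 0 <= s <= 1 -> 0 <= t <= 1 ->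
  `|s ^+ n - t ^+ n| <= n%:R * `|s - t|.
Proof.
move=> /andP[s0 s1] /andP[t0 t1]; elim: n => [|n IH].
  by rewrite subrr normr0 mul0r.
have -> : s ^+ n.+1 - t ^+ n.+1 = s * (s ^+ n - t ^+ n) + (s - t) * t ^+ n.
  by rewrite !exprS; ring.
rewrite (le_trans (ler_normD _ _))// -natr1 [leRHS]mulrDl mul1r lerD//.
  by rewrite normrM ger0_norm// (le_trans _ IH)// ler_piMl.
by rewrite normrM ler_piMr// ger0_norm ?exprn_ge0// exprn_ile1.
Qed.

Section BerezinRange.
Variables (R : realType) (beta : R[i]).
Hypothesis b1 : normc beta < 1.
Implicit Types (s t r : R) (z l : R[i]).

Lemma shift_symbol_lipschitz : exists2 K : R, 0 <= K &
  forall s t, 0 <= s <= 1 -> 0 <= t <= 1 ->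
    normc (shift_symbol beta s - shift_symbol beta t) <= K * `|s - t|.
Proof.
have b01 : 0 <= normc beta < 1 by rewrite normc_ge0.
have cK := is_cvg_series_succ_sqr_expr b01.
set v : R^nat := fun n => n.+1%:R ^+ 2 * normc beta ^+ n.
have v0 n : 0 <= v n by rewrite mulr_ge0 ?exprn_ge0// normc_ge0.
exists (limn (series v)).
  by apply: limr_ge cK _; apply: nearW => n; apply: sumr_ge0 => k _; exact: v0.
move=> s t s01 t01; rewrite mulrC.
apply: (normc_lim_series_le _ (cvg_seriesB (cvg_shift_symbol b1 s01)
  (cvg_shift_symbol b1 t01)) (cvg_seriesZ (k := `|s - t|) cK)) => n.
have -> : (Num.sqrt n.+1%:R)%:C * (s%:C * beta) ^+ n -
    (Num.sqrt n.+1%:R)%:C * (t%:C * beta) ^+ n =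
    (Num.sqrt n.+1%:R * (s ^+ n - t ^+ n))%:C * beta ^+ n.
  by rewrite rmorphM rmorphB !rmorphXn !exprMn; ring.
rewrite normcM normcX normc_real [leRHS]mulrA ler_wpM2r ?exprn_ge0 ?normc_ge0//.
rewrite normrM expr2 [leRHS]mulrCA ler_pM//.
  by rewrite ger0_norm ?sqrtr_ge0 ?sqrtr_succ_le.
rewrite mulrC (le_trans (ler_dist_expr _ s01 t01))// ler_wpM2r// ler_nat//.
Qed.

Lemma shift_symbol0 : shift_symbol beta 0 = 1.
Proof.
rewrite /shift_symbol; set u := (X in series X).
have -> : u = (fun n => if n == 0%N then 1 else 0).
  apply/funext => -[|n]; rewrite /u; first by rewrite expr0 mulr1 sqrtr1.
  by rewrite mul0r expr0n mulr0.
exact/cvg_lim_complex/cvg_series_delta.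
Qed.

Definition berezin_radius r := r * (1 - r ^+ 2) ^+ 2 * normc (shift_symbol beta (r ^+ 2)).

Lemma itv01_sqr r : 0 <= r <= 1 -> 0 <= r ^+ 2 <= 1.
Proof. by move=> /andP[r0 r1]; rewrite sqr_ge0 expr_le1. Qed.

Lemma berezin_radius_continuous : {within `[0, 1], continuous berezin_radius}.
Proof.
have [K K0 KL] := shift_symbol_lipschitz.
apply/subspace_continuousP => x; rewrite /= in_itv/= => x01; apply: cvgM.
  apply: cvg_within_filter.
  apply: cvgM; first exact: cvg_id.
  have h : (1 - r ^+ 2) @[r --> x] --> 1 - x ^+ 2.
    by apply: cvgB; [exact: cvg_cst|exact: exprn_continuous].
  exact: (cvgM h h).
apply/cvgrPdist_lt => e e0.
have d0 : 0 < e / (2 * K + 1) by rewrite divr_gt0//; lra.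
rewrite near_withinE; near=> r; move=> r01.
rewrite /= in_itv/= in r01.
have rx : `|x - r| < e / (2 * K + 1).
  by near: r; apply: cvgr_dist_lt => //; exact: cvg_id.
set a := shift_symbol beta (x ^+ 2); set b := shift_symbol beta (r ^+ 2).
have ab : normc (a - b) <= K * `|x ^+ 2 - r ^+ 2| by rewrite KL ?itv01_sqr.
apply: (@le_lt_trans _ _ (K * (2 * `|x - r|))).
  apply: (@le_trans _ _ (normc (a - b))).
    exact: ler_dist_normc.
  apply: (le_trans ab); rewrite ler_wpM2l//.
  by rewrite ler_dist_expr.
rewrite ltr_pdivlMr in rx; last lra.
apply: le_lt_trans rx; rewrite -subr_ge0.
by have -> : `|x - r| * (2 * K + 1) - K * (2 * `|x - r|) = `|x - r| by ring.
Unshelve. all: by end_near. Qed.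

Lemma berezin_radius_gt0 : exists2 r, 0 <= r <= 1 & 0 < berezin_radius r.
Proof.
have [K K0 KL] := shift_symbol_lipschitz.
pose t : R := (2 * (K + 1))^-1.
have t0 : 0 < t by rewrite invr_gt0; lra.
have tK : t * (2 * (K + 1)) = 1 by rewrite mulVf// gt_eqF//; lra.
have t1 : t <= 2^-1 by nra.
have s2 : Num.sqrt t ^+ 2 = t by rewrite sqr_sqrtr// ltW.
have s0 : 0 < Num.sqrt t by rewrite sqrtr_gt0.
exists (Num.sqrt t).
  by rewrite (ltW s0)/= -[leRHS]sqrtr1 ler_wsqrtr//; lra.
have t01 : 0 <= t <= 1 by lra.
have G0 : 0 < normc (shift_symbol beta t).
  have := KL 0 t; rewrite lexx ler01 shift_symbol0 sub0r normrN => /(_ isT t01).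
  rewrite ger0_norm ?(ltW t0)// => h.
  have := le_trans (ler_dist_normc _ _) h.
  by rewrite normc1 ler_distlC; move: (normc _) => g /andP[+ _]; nra.
rewrite /berezin_radius s2; apply: mulr_gt0 => //; apply: mulr_gt0 => //.
by rewrite exprn_gt0//; lra.
Qed.

Lemma Ber_disc T : weighted_shift (fun n => beta ^+ n.-1) T ->
  exists2 r : R, 0 < r & Ber T = [set z | `|z| <= r%:C].
Proof.
move=> wT.
have bd : unit_disc beta by rewrite unit_discE.
have value l (ld : unit_disc l) :=
  berezin_weighted_shift bd ld (bergman_normalized_kernel ld) wT.
have [c c01 cmax] := EVT_max ler01 berezin_radius_continuous.
have phic0 : 0 < berezin_radius c.
  have [r r01 rgt0] := berezin_radius_gt0; apply: lt_le_trans rgt0 _.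
  by apply: cmax; rewrite in_itv.
have normcB l :
    normc ((1 - (normc l ^+ 2)%:C) ^+ 2 * l * shift_symbol beta (normc l ^+ 2)) =
    berezin_radius (normc l).
  rewrite 2!normcM normcX -(rmorph1 (real_complex R)) -rmorphB.
  by rewrite normc_real real_normK ?num_real// [_ * normc l]mulrC.
exists (berezin_radius c) => //; apply/seteqP; split => [_ [l ld <-]|w].
  rewrite /mkset value// normr_normc lecR.
  by rewrite normcB cmax// in_itv/= normc_ge0 ltW// -unit_discE.
rewrite /mkset normr_normc lecR => wc.
rewrite in_itv/= in c01; have /andP[c0 c1] := c01.
have phi0 : berezin_radius 0 = 0 by rewrite /berezin_radius !mul0r.
have phi1 : berezin_radius 1 = 0.
  by rewrite /berezin_radius expr1n subrr expr0n mulr0 mul0r.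
have c1' : c < 1.
  by rewrite lt_neqAle c1 andbT; apply: contraTneq phic0 => ->; rewrite phi1 ltxx.
have [||r rc rw] := @IVT R berezin_radius 0 c (normc w) c0.
- apply: continuous_subspaceW berezin_radius_continuous => x.
  by rewrite /= !in_itv/= => /andP[-> /le_trans->].
- rewrite phi0 (min_l (ltW phic0)) (max_r (ltW phic0)).
  by rewrite normc_ge0.
rewrite in_itv/= in rc; have /andP[r0 rlec] := rc.
have r1 : r < 1 by apply: le_lt_trans c1'.
have [w0|w0] := eqVneq w 0.
  have z0 : unit_disc (0 : R[i]) by rewrite unit_discE normc0.
  by exists 0 => //; rewrite value// mulr0 mul0r w0.
have rC : normc r%:C = r by rewrite normc_real ger0_norm.
pose k := (1 - (r ^+ 2)%:C) ^+ 2 * shift_symbol beta (r ^+ 2).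
have kr : normc (r%:C * k) = normc w.
  by rewrite -rw -[in RHS]rC -normcB rC /k; congr normc; ring.
have kr0 : r%:C * k != 0 by rewrite -normc_eq0 kr normc_eq0.
(* Rotating [r] by the unit number [w / (r k)] moves the value at [r] to [w]. *)
pose l := r%:C * (w / (r%:C * k)).
have nl : normc l = r.
  rewrite /l normcM normcM normcV kr divff ?mulr1// normc_eq0//.
have ld : unit_disc l by rewrite unit_discE nl.
exists l => //; rewrite value// nl.
have -> : (1 - (r ^+ 2)%:C) ^+ 2 * l * shift_symbol beta (r ^+ 2) =
  r%:C * k * (w / (r%:C * k)) by rewrite /l /k; ring.
by rewrite mulrC divfK.
Qed.
End BerezinRange.

Lemma convex_closed_disc (R : realType) (r : R) :
  @convex_set R (Rcomplex R) [set z : R[i] | `|z| <= r%:C].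
Proof.
have normcZ (p : R) (z : R[i]) : normc (p *: (z : Rcomplex R)) = `|p| * normc z.
  rewrite -normc_real -normcM; congr normc; case: z => a b.
  by rewrite /GRing.scale/=; simpc.
move=> x y p /set_mem; rewrite /mkset normr_normc lecR => xr.
move=> /set_mem; rewrite /mkset normr_normc lecR => yr.
apply/mem_set; rewrite /mkset normr_normc lecR.
rewrite (le_trans (le_normcD _ _))// !normcZ.
have /andP[p0 p1] : 0 <= p%:num <= 1 by apply/andP; split.
rewrite !ger0_norm ?subr_ge0//=.
have := ler_wpM2l p0 xr.
have q0 : 0 <= 1 - p%:num by rewrite subr_ge0.
have := ler_wpM2l q0 yr; rewrite /unstable.onem; lra.
Qed.

(* Convexity is over the real scalars: Rcomplex R is R[i] as an R-module. *)
Theorem theorem3p7 (R : realType) (beta : R[i])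
    (T : (R[i] -> R[i]) -> (R[i] -> R[i])) :
  unit_disc beta ->
  weighted_shift (fun n => beta ^+ n.-1) T ->
  centred_disc (Ber T) /\ @convex_set R (Rcomplex R) (Ber T).
Proof.
rewrite unit_discE => b1 /(Ber_disc b1)[r r0 ->]; split.
  by exists r => //; right.
exact: convex_closed_disc.
Qed.
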